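(* Let $F$ be a 4-regular graph with $n$ vertices. Let $P_1$ and $P_2$ be circuit partitions of $F$, and for $v\in V(F)$ let $\tau_1(v),\tau_2(v)$ be the transitions at $v$ involved in $P_1$ and $P_2$ respectively. Suppose $\tau_1(v)\neq\tau_2(v)$ for all $v\in V(F)$. Then for any basis $B_1$ of $M_{\tau}(P_1)$, the set \[ B_1\cup\{\tau_2(v)\mid \tau_1(v)\notin B_1\} \] is a basis of $M_{\tau}(F)$. Consequently \[ r(\tau(P_1)\cup\tau(P_2)) = n \le r(\tau(P_1))+r(\tau(P_2)), \] where $r$ is the rank function of $M_{\tau}(F)$.
   Context: Graphs may have loops and multiple edges; each edge consists of two half-edges, each incident on one vertex; a 4-regular graph has four half-edges at each vertex. A transition at $v$ is a partition of the four half-edges at $v$ into two pairs; $\mathfrak{T}(F)$ is the set of transitions. A circuit is a closed walk using pairwise distinct half-edges (up to cyclic permutation and reversal). A circuit partition $P$ of $F$ partitions $E(F)$ into circuits; at each vertex its passages determine a transition, and $\tau(P)$ is the set of these transitions (one per vertex). An Euler system is a circuit partition with one circuit per connected component. For an Euler system $C$: $v\neq w$ are interlaced if they appear as $v\dots w\dots v\dots w$ on a circuit of $C$, and $\mathcal{A}$ is the $GF(2)$ adjacency matrix of the interlacement graph on $V(F)$; $\phi_C(v)$ is the transition of $C$ at $v$, $\chi_C(v)$ the other transition pairing entering with leaving half-edges under an orientation of the circuit, $\psi_C(v)$ the third. The transition matroid $M_{\tau}(F)$ is the binary matroid on $\mathfrak{T}(F)$ represented by $(I\mid\mathcal{A}\mid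 I+\mathcal{A})$ with the columns for $v$ indexed by $\phi_C(v),\chi_C(v),\psi_C(v)$; it does not depend on $C$. $M_{\tau}(P)$ denotes the restriction of $M_{\tau}(F)$ to $\tau(P)$. *)

(* Defs.v *)
From HB Require Import structures.
From mathcomp Require Import all_boot all_order all_algebra.

Set Implicit Arguments.
Unset Strict Implicit.
Unset Printing Implicit Defensive.

Import GRing.Theory.

Record matroid (T : finType) := Matroid {
  ground : {set T};
  indep : pred {set T};
  indep_ground : forall A, indep A -> A \subset ground;
  indep0 : indep set0;
  indepS : forall A B : {set T}, A \subset B -> indep B -> indep A;
  indep_exchange : forall A B : {set T}, indep A -> indep B -> #|A| < #|B| ->
    exists2 x, x \in B :\: A & indep (x |: A)
}.

Definition basis (T : finType) (M : matroid T) (B : {set T}) : bool :=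
  maxset (indep M) B.

Definition rank (T : finType) (M : matroid T) (S : {set T}) : nat :=
  \max_(A : {set T} | (A \subset S) && indep M A) #|A|.

Section Restriction.
Variables (T : finType) (M : matroid T) (S : {set T}).

Let E := ground M :&: S.
Let I := [pred A : {set T} | (A \subset S) && indep M A].

Fact restrict_ground A : I A -> A \subset E.
Proof. by case/andP=> sAS /indep_ground sAM; rewrite subsetI sAM. Qed.

Fact restrict0 : I set0.
Proof. by rewrite /= sub0set indep0. Qed.

Fact restrictS (A B : {set T}) : A \subset B -> I B -> I A.
Proof.
by move=> sAB /andP[sBS iB]; rewrite /= (subset_trans sAB sBS) (indepS sAB iB).
Qed.

Fact restrict_exchange (A B : {set T}) : I A -> I B -> #|A| < #|B| ->
  exists2 x, x \in B :\: A & I (x |: A).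
Proof.
move=> /andP[sAS iA] /andP[sBS iB] /(indep_exchange iA iB)[x xBA ixA].
exists x => //=; rewrite ixA subUset sub1set sAS !andbT.
by case/setDP: xBA => /(subsetP sBS).
Qed.

Definition restrict : matroid T :=
  Matroid restrict_ground restrict0 restrictS restrict_exchange.
End Restriction.

Section Represented.
Variables (T : finType) (K : fieldType) (m k : nat).
Variables (E : {set T}) (lab : 'I_k -> T) (M : 'M[K]_(m, k)).

(* Meaningful when [lab] is a bijection from the column indices onto [E]. *)
Definition labelled_col (t : T) : 'cV[K]_m :=
  if [pick j | lab j == t] is Some j then col j M else 0%R.

Let I := [pred A : {set T} |
  (A \subset E) && free [seq labelled_col t | t <- enum A]].

Fact represented_ground A : I A -> A \subset E.
Proof. by case/andP. Qed.

Fact represented0 : I set0.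
Proof. by rewrite /= sub0set enum_set0 nil_free. Qed.

Fact representedS (A B : {set T}) : A \subset B -> I B -> I A.
Proof.
move=> sAB /andP[sBE fB]; rewrite /= (subset_trans sAB sBE) /=.
have pB : perm_eq (enum B) (enum A ++ enum (B :\: A)).
  apply: uniq_perm; rewrite ?enum_uniq //.
    rewrite cat_uniq !enum_uniq andbT /=; apply/hasPn => x.
    by rewrite !mem_enum inE => /andP[].
  move=> x; rewrite mem_cat !mem_enum inE.
  by case: (boolP (x \in A)) => //= /(subsetP sAB).
move: fB; rewrite (perm_free (perm_map labelled_col pB)) map_cat.
exact: catl_free.
Qed.

Fact represented_exchange (A B : {set T}) : I A -> I B -> #|A| < #|B| ->
  exists2 x, x \in B :\: A & I (x |: A).
Proof.
move=> /andP[sAE fA] /andP[sBE fB] ltAB.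
pose X := [seq labelled_col t | t <- enum A].
have [sBA | ] := boolP [forall x in B, labelled_col x \in <<X>>%VS].
  have: (<<[seq labelled_col t | t <- enum B]>> <= <<X>>)%VS.
    apply/span_subvP => y /mapP[x]; rewrite mem_enum => xB ->{y}.
    by move/forall_inP: sBA; apply.
  move/dimvS; rewrite (eqP fB) (eqP fA) !size_map -!cardE.
  by rewrite leqNgt ltAB.
case/forall_inPn=> x xB xX.
have xA : x \notin A.
  by apply: contra xX => xA; apply/memv_span/map_f; rewrite mem_enum.
exists x; first by rewrite inE xA.
rewrite /= subUset sub1set (subsetP sBE _ xB) sAE /=.
have pA : perm_eq (enum (x |: A)) (x :: enum A).
  apply: uniq_perm; rewrite /= ?enum_uniq ?mem_enum ?xA //.
  by move=> y; rewrite in_cons !mem_enum !inE.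
by rewrite (perm_free (perm_map labelled_col pA)) /= free_cons xX.
Qed.

(* The matroid on [E] represented by [M], the column [j] being labelled by the
   element [lab j]. *)
Definition represented : matroid T :=
  Matroid represented_ground represented0 representedS represented_exchange.
End Represented.

(* [opp h] is the other half of the edge containing [h]; loops are the edges
   with [inc (opp h) = inc h], and multiple edges are allowed. *)
Record graph4 := Graph4 {
  vertex : finType;
  half_edge : finType;
  opp : half_edge -> half_edge;
  inc : half_edge -> vertex;
  oppK : involutive opp;
  opp_neq : forall h, opp h != h;
  regular4 : forall v, #|[set h | inc h == v]| = 4
}.

Arguments opp {g}.
Arguments inc {g}.

Section Graph4.
Variable F : graph4.
Notation V := (vertex F).
Notation H := (half_edge F).
Notation n := #|vertex F|.

Definition halves_at (v : V) : {set H} := [set h | inc h == v].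

Definition edge_of (h : H) : {set H} := [set h; opp h].

Definition edges : {set {set H}} := [set edge_of h | h : H].

Definition transitions_at (v : V) : {set {set {set H}}} :=
  [set t | partition t (halves_at v) & [forall p in t, #|p| == 2]].

Definition transitions : {set {set {set H}}} :=
  \bigcup_(v : V) transitions_at v.

(* The closed walk v1, h1, opp h1, v2, h2, opp h2, ..., hk, opp hk, v1 with
   v_i = inc h_i is represented by the sequence h1, ..., hk of the half-edges
   along which it leaves its vertices.  A circuit is given by any of its walks;
   cyclic permutations and reversals are not quotiented out. *)
Definition circuit (c : seq H) : bool :=
  [&& c != [::], cycle (fun h h' => inc (opp h) == inc h') c
    & uniq (c ++ map opp c)].

Definition circuit_partition (P : seq (seq H)) : bool :=
  all circuit P && perm_eq [seq edge_of h | h <- flatten P] (enum edges).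

(* c enters a vertex through opp h and leaves it through next c h. *)
Definition passages (c : seq H) : seq (H * H) :=
  [seq (opp h, next c h) | h <- c].

Definition tau (P : seq (seq H)) (v : V) : {set {set H}} :=
  [set [set p.1; p.2] | p in [seq p <- flatten (map passages P) | inc p.1 == v]].

Definition tau_set (P : seq (seq H)) : {set {set {set H}}} :=
  [set tau P v | v : V].

Definition adjacent : rel V :=
  fun v w => [exists h : H, (inc h == v) && (inc (opp h) == w)].

Definition euler_system (C : seq (seq H)) : bool :=
  circuit_partition C &&
  [forall v : V, count (has (fun h => connect adjacent v (inc h))) C == 1].

Definition interlaced (C : seq (seq H)) : rel V := fun v w =>
  (v != w) && has (fun c => [exists k : 'I_(size c),
                     subseq [:: v; w; v; w] (rot k (map inc c))]) C.

Definition interlacement_mx (C : seq (seq H)) : 'M['F_2]_n :=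
  \matrix_(i, j) (interlaced C (enum_val i) (enum_val j))%:R%R.

(* Half-edges leaving (resp. entering) their vertex, each circuit of C being
   oriented by the walk that represents it. *)
Definition leaving (C : seq (seq H)) : {set H} := [set h in flatten C].
Definition entering (C : seq (seq H)) : {set H} := [set opp h | h in leaving C].

Definition respects_orientation (C : seq (seq H)) (t : {set {set H}}) : bool :=
  [forall p in t, (#|p :&: entering C| == 1) && (#|p :&: leaving C| == 1)].

Definition phi (C : seq (seq H)) (v : V) : {set {set H}} := tau C v.

(* When C is a circuit partition, exactly one transition satisfies the
   condition in [chi] (resp. in [psi]), so the default [set0] is never used. *)
Definition chi (C : seq (seq H)) (v : V) : {set {set H}} :=
  odflt set0 [pick t in transitions_at v |
                (t != phi C v) && respects_orientation C t].

Definition psi (C : seq (seq H)) (v : V) : {set {set H}} :=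
  odflt set0 [pick t in transitions_at v | (t != phi C v) && (t != chi C v)].

Definition transition_label (C : seq (seq H)) (j : 'I_(n + n + n)) :
    {set {set H}} :=
  match split j with
  | inl j' => match split j' with
              | inl i => phi C (enum_val i)
              | inr i => chi C (enum_val i)
              end
  | inr i => psi C (enum_val i)
  end.

Definition transition_mx (C : seq (seq H)) : 'M['F_2]_(n, n + n + n) :=
  let A := interlacement_mx C in row_mx (row_mx 1%:M A) (1%:M + A)%R.

Definition transition_matroid (C : seq (seq H)) : matroid {set {set H}} :=
  represented transitions (transition_label C) (transition_mx C).

End Graph4.

(* Main.v *)
(* At each vertex the columns of phi, chi, psi are the three nonzero
   combinations of the columns of I and A, so that a set of transitions, at most
   one per vertex, is dependent exactly when it supports a nonzero vector of the
   space {(x, y) | x + A y = 0}.  This space is totally isotropic for the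
   symplectic form because A is symmetric, and the form vanishes at a vertex
   exactly when the two transitions used there are equal.  Pair a dependency z
   of the new transversal with the fundamental circuit of tau1(u) with respect
   to B1, for u with tau1(u) outside B1: only the vertex u can contribute, so z
   vanishes at u.  Hence z is supported by B1, and z = 0. *)
From mathcomp Require Import all_boot all_order all_algebra all_fingroup.
Require Import Defs.

Set Implicit Arguments.
Unset Strict Implicit.
Unset Printing Implicit Defensive.

Import GRing.Theory.

(** * Linear algebra of the isotropic space attached to a symmetric matrix *)

Section Isotropic.
Local Open Scope ring_scope.
Variables (K : fieldType) (n : nat) (A : 'M[K]_n).
Hypothesis symA : A^T = A.

Definition isotropic_col (p : K * K) (i : 'I_n) : 'cV[K]_n :=
  p.1 *: delta_mx i 0 + p.2 *: col i A.

(** Let [x], [y] collect the coefficients of one relation on the columns of the identity and of [A],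
    and [x'], [y'] those of the other. The relations read [x = - A y] and [x' = - A y'], and
    symmetry of [A] gives [x^T y' = - y^T A y' = y^T x']. *)
Lemma isotropic_col_pairing (p q : 'I_n -> K * K) (c d : 'I_n -> K) :
    \sum_i c i *: isotropic_col (p i) i = 0 ->
    \sum_i d i *: isotropic_col (q i) i = 0 ->
  \sum_i c i * d i * ((p i).1 * (q i).2 - (p i).2 * (q i).1) = 0.
Proof.
pose x (r : 'I_n -> K * K) (e : 'I_n -> K) := \col_i (e i * (r i).1).
pose y (r : 'I_n -> K * K) (e : 'I_n -> K) := \col_i (e i * (r i).2).
have split r e : \sum_i e i *: isotropic_col (r i) i = x r e + A *m y r e.
  apply/colP=> k; rewrite summxE !mxE.
  under eq_bigr do rewrite !mxE mulrDr !mulrA.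
  rewrite big_split /=; congr (_ + _).
    rewrite (bigD1 k) //= big1 ?addr0 ?eqxx ?mulr1 // => j /negPf kj.
    by rewrite eq_sym kj mulr0.
  by apply: eq_bigr => j _; rewrite !mxE [RHS]mulrC.
rewrite !split => /eqP; rewrite addr_eq0 => /eqP xp.
move=> /eqP; rewrite addr_eq0 => /eqP xq.
have: (x p c)^T *m y q d = (y p c)^T *m x q d.
  by rewrite xp xq linearN /= trmx_mul symA mulNmx mulmxN mulmxA.
move/matrixP/(_ 0 0); rewrite !mxE => /eqP.
rewrite -subr_eq0 -sumrB => /eqP diff0; rewrite -[RHS]diff0.
by apply: eq_bigr => i _; rewrite !mxE mulrBr; congr (_ - _); exact: mulrACA.
Qed.

Lemma isotropic_transversal (p q : 'I_n -> K * K) (S : {set 'I_n}) :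
    (forall i, i \notin S -> (p i).1 * (q i).2 - (p i).2 * (q i).1 != 0) ->
    (forall d, \sum_(i in S) d i *: isotropic_col (p i) i = 0 ->
       {in S, d =1 fun=> 0}) ->
    (forall u, u \notin S -> exists c,
       isotropic_col (p u) u = \sum_(i in S) c i *: isotropic_col (p i) i) ->
  forall d, \sum_i d i *: isotropic_col (if i \in S then p i else q i) i = 0 ->
    d =1 fun=> 0.
Proof.
move=> pq freeS spanS d d0.
have dS u : u \notin S -> d u = 0.
  move=> uS; have [c cu] := spanS u uS.
  (* The fundamental circuit of [u] over [S]: coefficient 1 at [u] balanced by the negated expansion
     of its column. *)
  pose c' i := if i == u then 1 else if i \in S then - c i else 0.
  have c'0 : \sum_i c' i *: isotropic_col (p i) i = 0.
    rewrite (bigD1 u) //= {1}/c' eqxx scale1r cu.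
    rewrite (bigID (mem S) (fun i => i != u)) /=.
    rewrite [X in _ + (_ + X)]big1 ?addr0 => [|i /andP[/negPf iu /negPf iS]].
      rewrite [X in _ + X](eq_bigl (mem S)) => [|i /=]; last first.
        by case: eqP => [->|]; rewrite ?(negPf uS).
      rewrite -big_split big1 //= => i iS.
      have /negPf iu : i != u by apply: contraNneq uS => <-.
      by rewrite /c' iu iS -scalerDl subrr scale0r.
    by rewrite /c' iu iS scale0r.
  have := isotropic_col_pairing c'0 d0.
  rewrite (bigD1 u) //= big1 ?addr0 => [|i iu].
    rewrite /c' eqxx mul1r (negPf uS) => /eqP.
    by rewrite mulf_eq0 (negPf (pq u uS)) orbF => /eqP.
  (* On [S] both relations use [p i], so the alternating form vanishes there; off [S] and away from
     [u], [c'] is zero. *)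
  case: ifP => iS; first by rewrite [X in _ - X]mulrC subrr mulr0.
  by rewrite /c' (negPf iu) iS !mul0r.
move=> i; have [iS|/dS//] := boolP (i \in S).
apply: freeS iS; rewrite -[RHS]d0 [RHS](bigID (mem S)) /=.
rewrite [X in _ + X]big1 ?addr0 => [|j jS]; last by rewrite dS ?scale0r.
by apply: eq_bigr => j ->.
Qed.

End Isotropic.

(** * Independence and spanning in a represented matroid *)

Section RepresentedTheory.
Local Open Scope ring_scope.
Variables (T : finType) (K : fieldType) (m k : nat).
Variables (E : {set T}) (lab : 'I_k -> T) (M : 'M[K]_(m, k)).
Notation vec := (labelled_col lab M).
Notation R := (represented E lab M).

Lemma labelled_col_lab j : injective lab -> vec (lab j) = col j M.
Proof.
move=> inj_lab; rewrite /labelled_col.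
by case: pickP => [i /eqP/inj_lab-> //|/(_ j)]; rewrite eqxx.
Qed.

(** Indexing coefficients by elements rather than by positions in a list lets later sums be
    reindexed freely. Two elements with equal columns still count as dependent. *)
Lemma represented_indepP (A : {set T}) :
  reflect (A \subset E /\
           forall c : T -> K, \sum_(t in A) c t *: vec t = 0 ->
             {in A, c =1 fun=> 0})
          (indep R A).
Proof.
have sumE (c : T -> K) :
    \sum_(t in A) c t *: vec t =
    \sum_(i < size (enum A)) c (tnth (in_tuple (enum A)) i) *:
       [seq vec t | t <- enum A]`_i.
  rewrite -big_enum big_tnth; apply: eq_bigr => i _.
  have x0 := tnth (in_tuple (enum A)) i.
  by rewrite (nth_map x0) // (tnth_nth x0).
have sz : size [seq vec t | t <- enum A] == size (enum A) by rewrite size_map.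
apply: (iffP andP) => -[AE fA]; split=> //.
  move=> c; rewrite sumE => c0 t tA.
  have ltA : (index t (enum A) < size (enum A))%N by rewrite index_mem mem_enum.
  have /freeP/(_ _ c0 (Ordinal ltA)) : free (Tuple sz) by [].
  by rewrite (tnth_nth t) nth_index ?mem_enum.
have : free (Tuple sz) => //; apply/freeP => c c0 i.
(* Coefficients given by position are transported to elements; the default 0 is reached only outside
   [A]. *)
pose c' t := if insub (index t (enum A)) is Some j then c j else 0.
have c'E j : c' (tnth (in_tuple (enum A)) j) = c j.
  have x0 := tnth (in_tuple (enum A)) j.
  by rewrite /c' (tnth_nth x0) index_uniq ?enum_uniq //= valK.
rewrite -c'E; apply: fA; last by rewrite -mem_enum mem_tnth.
by rewrite sumE -[RHS]c0; apply: eq_bigr => j _; rewrite c'E.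
Qed.

Lemma represented_card_indep (A : {set T}) : indep R A -> (#|A| <= m)%N.
Proof.
move=> /andP[_] /eqP; rewrite size_map -cardE => <-.
by rewrite (leq_trans (dimvS (subvf _))) // dimvf /dim /= muln1.
Qed.

(** If the column of [t] lay outside the span, [t |: B] would be a larger independent subset of [S],
    against maximality. *)
Lemma restrict_basis_span (S B : {set T}) (t : T) :
    basis (restrict R S) B -> t \in S -> t \in E -> t \notin B ->
  exists c : T -> K, vec t = \sum_(b in B) c b *: vec b.
Proof.
case/maxsetP=> /andP[BS /andP[BE fB]] maxB tS tE tB.
suff /(free_span fB)[c -> _] : vec t \in <<[seq vec b | b <- enum B]>>%VS.
  by exists (c \o vec); rewrite big_map big_enum.
apply: contraNT tB => spanB; rewrite -(maxB (t |: B)) ?setU11 ?subsetU1 //.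
have [tB|tB] := boolP (t \in B).
  by rewrite (setUidPr _) ?sub1set //= BS BE fB.
rewrite /= !subUset !sub1set tS BS tE BE /=.
have pB : perm_eq (enum (t |: B)) (t :: enum B).
  apply: uniq_perm; rewrite /= ?enum_uniq ?mem_enum ?tB //.
  by move=> y; rewrite in_cons !mem_enum !inE.
by rewrite (perm_free (perm_map vec pB)) /= free_cons spanB.
Qed.

End RepresentedTheory.

(** * Auxiliary facts on sequences and rotations *)

Lemma uniq_map_inj (T1 T2 : eqType) (f : T1 -> T2) (s : seq T1) :
  uniq (map f s) -> {in s &, injective f}.
Proof.
elim: s => //= a s IHs /andP[fa fs] x y; rewrite !inE.
case/predU1P=> [->|xs] /predU1P[->|ys] // fxy; last exact: IHs.
  by rewrite fxy map_f in fa.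
by rewrite -fxy map_f in fa.
Qed.

(** The sequences of [P] are disjoint, so the functions [f c] glue to one. This turns [next] and
    [prev], defined circuit by circuit, into global maps. *)
Lemma flatten_piecewise (T : eqType) (f : seq T -> T -> T) (P : seq (seq T)) :
  uniq (flatten P) -> exists s, {in P, forall c, {in c, s =1 f c}}.
Proof.
elim: P => [|c P IHP] /=; first by exists id.
rewrite cat_uniq => /and3P[_ /hasPn ncP /IHP[s sP]].
exists (fun x => if x \in c then f c x else s x) => b.
rewrite inE => /predU1P[->|bP] x xb; first by rewrite xb.
rewrite ifN; first exact: sP.
by apply: ncP; apply/flattenP; exists b.
Qed.

Lemma subseq_cons_split (T : eqType) (x : T) (q r : seq T) :
  subseq (x :: q) r -> exists a b, r = a ++ x :: b /\ subseq q b.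
Proof.
elim: r => //= y r IHr; case: eqP => [<-|_] /=; first by exists [::], r.
by case/IHr=> a [b [-> qb]]; exists (y :: a), b.
Qed.

Lemma subseq_alternate (T : eqType) (x y : T) (s : seq T) (k : 'I_(size s)) :
    subseq [:: x; y; x; y] (rot k s) ->
  exists j : 'I_(size s), subseq [:: y; x; y; x] (rot j s).
Proof.
case/subseq_cons_split=> a [b [rE yb]].
have sz : size (rot k s) = size s by rewrite size_rot.
(* Rotating just past the first [x] moves it to the end, behind the remaining [y], [x], [y]. *)
have: subseq [:: y; x; y; x] (rot (size (rcons a x)) (rot k s)).
  rewrite rE -cat_rcons rot_size_cat.
  rewrite -[[:: y; x; y; x]]/([:: y; x; y] ++ [:: x]).
  by apply: cat_subseq => //; rewrite -cats1 suffix_subseq.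
have ltk : size (rcons a x) <= size s.
  by rewrite -sz rE -cat_rcons size_cat leq_addr.
rewrite rot_add_mod ?(ltnW (ltn_ord k)) //; set j := if _ then _ else _.
have lej : j <= size s.
  by rewrite /j; case: ifP => // _; rewrite leq_subLR leq_add // ltnW.
have s0 : 0 < size s := leq_ltn_trans (leq0n k) (ltn_ord k).
(* An ordinal index must be below [size s]; the rotation by [size s] is replaced by the rotation by
   0. *)
move: lej; rewrite leq_eqVlt => /predU1P[->|ltj]; last by exists (Ordinal ltj).
by rewrite rot_size -[X in subseq _ X]rot0; exists (Ordinal s0).
Qed.

(** * Transitions, circuit partitions and interlacement in a 4-regular graph *)

Section Graph4Theory.
Variable F : graph4.
Notation H := (half_edge F).
Implicit Types (v : vertex F) (P : seq (seq H)) (h : H) (g : H -> H).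

(** A transition is encoded by a pairing [g] of half-edges, so that a single map describes the
    transitions at all vertices at once. *)
Definition transition_of g v : {set {set H}} :=
  [set [set h; g h] | h in halves_at v].

Lemma transition_ofP g v :
    involutive g -> (forall h, inc (g h) = inc h) -> (forall h, g h != h) ->
  transition_of g v \in transitions_at v.
Proof.
move=> gK incg gN; rewrite inE; apply/andP; split; last first.
  by apply/forall_inP=> p /imsetP[h _ ->]; rewrite cards2 [h == _]eq_sym gN.
apply/and3P; split; first last.
- by apply/imsetP=> -[h _ /setP/(_ h)]; rewrite !inE eqxx.
- apply/trivIsetP=> _ _ /imsetP[h _ ->] /imsetP[k _ ->].
  apply: contraR => /pred0Pn[x /=]; rewrite !inE.
  case/andP=> /orP[]/eqP-> /orP[] /eqP.
  + by move->.
  + by move=> ->; rewrite gK setUC.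
  + by move <-; rewrite gK setUC.
  + by move/(can_inj gK)->.
rewrite eqEsubset; apply/andP; split; apply/subsetP=> h.
  case/bigcupP=> p /imsetP[k]; rewrite inE => /eqP kv ->.
  by rewrite !inE => /orP[]/eqP->; rewrite ?incg kv.
move=> hv; apply/bigcupP; exists [set h; g h]; last by rewrite !inE eqxx.
exact: imset_f.
Qed.

(** The walks of [P] list exactly one half-edge of each edge: at least one because every edge is
    covered, at most one because no edge is repeated. *)
Lemma circuit_partition_opp P h :
  circuit_partition P -> (opp h \in flatten P) = (h \notin flatten P).
Proof.
case/andP=> _ permP; set L := flatten P.
have: edge_of h \in [seq edge_of h | h <- L].
  by rewrite (perm_mem permP) mem_enum imset_f.
case: (boolP (h \in L)) => [hL _|hL /mapP[k kL hk]] /=.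
  apply: contraNF (opp_neq h) => hL'; apply/eqP.
  have injL : {in L &, injective (@edge_of F)}.
    by apply: uniq_map_inj; rewrite (perm_uniq permP) enum_uniq.
  by apply: injL => //; rewrite /edge_of oppK setUC.
have := set21 k (opp k); rewrite -/(edge_of k) -hk !inE.
by case/orP=> /eqP kE; rewrite -kE ?kL // in hL *; rewrite kL in hL.
Qed.

(** The map [g] sends a half-edge to its partner in the passage through its vertex; it exchanges
    leaving and entering half-edges. *)
Lemma circuit_partition_pairing P : circuit_partition P ->
  exists g, [/\ involutive g, forall h, inc (g h) = inc h,
    forall h, (g h \in flatten P) = (h \notin flatten P)
    & forall v, tau P v = transition_of g v].
Proof.
move=> hP; case/andP: (hP) => /allP circP permP; set L := flatten P.
have uniqL : uniq L.
  by rewrite (@map_uniq _ _ (@edge_of F)) // (perm_uniq permP) enum_uniq.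
have oppL h := circuit_partition_opp h hP.
have [nx nxE] := flatten_piecewise (@next H) uniqL.
have [pv pvE] := flatten_piecewise (@prev H) uniqL.
have uniqc c : c \in P -> uniq c.
  by move=> /circP/and3P[_ _]; rewrite cat_uniq => /andP[].
have nxL h : h \in L -> nx h \in L.
  case/flattenP=> c cP hc; apply/flattenP; exists c => //.
  by rewrite (nxE c) ?mem_next.
have pvL h : h \in L -> pv h \in L.
  case/flattenP=> c cP hc; apply/flattenP; exists c => //.
  by rewrite (pvE c) ?mem_prev.
have nxK h : h \in L -> pv (nx h) = h.
  case/flattenP=> c cP hc.
  by rewrite (nxE c) // (pvE c) ?mem_next // prev_next ?uniqc.
have pvK h : h \in L -> nx (pv h) = h.
  case/flattenP=> c cP hc.
  by rewrite (pvE c) // (nxE c) ?mem_prev // next_prev ?uniqc.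
have inc_nx h : h \in L -> inc (nx h) = inc (opp h).
  case/flattenP=> c cP hc; rewrite (nxE c) //.
  by have /and3P[_ /next_cycle/(_ hc)/eqP] := circP c cP.
(* A leaving [h] is preceded by the arrival through [opp (pv h)]; an entering [h] is followed by the
   departure along [nx (opp h)]. *)
pose g h := if h \in L then opp (pv h) else nx (opp h).
have gL h : (g h \in L) = (h \notin L).
  rewrite /g; have [hL|hL] := ifPn; first by rewrite oppL pvL.
  by rewrite nxL ?oppL.
exists g; split=> // [h|h|v].
- rewrite {1}/g gL /g; case: (boolP (h \in L)) => hL /=.
    by rewrite oppK pvK.
  by rewrite nxK ?oppL // oppK.
- rewrite /g; case: ifP => hL; last by rewrite inc_nx ?oppL ?hL // oppK.
  by rewrite -inc_nx ?pvL // pvK.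
have passE : flatten (map (@passages F) P) = [seq (opp h, nx h) | h <- L].
  rewrite /L map_flatten; congr flatten; apply/eq_in_map => c cP.
  by apply/eq_in_map => h hc; rewrite (nxE c).
apply/setP=> p; rewrite /tau passE; apply/imsetP/imsetP=> -[].
  case=> x y; rewrite mem_filter /= => /andP[xv /mapP[h hL [xE yE]]] ->.
  exists x; first by rewrite inE.
  by rewrite /g xE oppL hL /= oppK yE.
move=> h; rewrite inE => hv ->.
have [hL|hL] := boolP (h \in L).
  exists (opp (pv h), h); last by rewrite /g hL setUC.
  rewrite mem_filter /= -inc_nx ?pvL // pvK // hv /=.
  by apply/mapP; exists (pv h); rewrite ?pvK ?pvL.
exists (h, nx (opp h)); last by rewrite /g (negPf hL).
rewrite mem_filter /= hv; apply/mapP; exists (opp h); first by rewrite oppL.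
by rewrite oppK.
Qed.

Lemma mem_entering P h :
  circuit_partition P -> (h \in entering P) = (h \notin flatten P).
Proof.
move=> hP; rewrite -circuit_partition_opp //; apply/imsetP/idP=> [[k]|hL].
  by rewrite inE => kL ->; rewrite oppK.
by exists (opp h); rewrite ?oppK ?inE.
Qed.

Lemma transition_of_respects P g v : circuit_partition P ->
    (forall h, (g h \in flatten P) = (h \notin flatten P)) ->
  respects_orientation P (transition_of g v).
Proof.
move=> hP gL; apply/forall_inP=> _ /imsetP[h _ ->].
have aux x y : x \in flatten P -> y \notin flatten P ->
    (#|[set x; y] :&: entering P| == 1) && (#|[set x; y] :&: leaving P| == 1).
  move=> xL yL; apply/andP; split; apply/cards1P; [exists y | exists x].
    apply/setP=> z; rewrite in_setI mem_entering // !inE.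
    case: eqP => [->|_]; last by case: eqP => // ->; rewrite yL.
    by rewrite xL /=; apply/esym/eqP=> xy; rewrite xy (negPf yL) in xL.
  apply/setP=> z; rewrite !inE.
  by case: eqP => [->|_]; last by case: eqP => // ->; rewrite (negPf yL).
have [hL|hL] := boolP (h \in flatten P); first by rewrite aux ?gL ?negbK.
by rewrite setUC aux ?gL.
Qed.

(* A transition respecting the orientation and different from phi is obtained by
   conjugating the pairing of phi by the exchange of two leaving, or of two
   entering, half-edges at v. *)
Lemma chi_spec P v : circuit_partition P ->
  (chi P v \in transitions_at v) && (chi P v != phi P v).
Proof.
move=> hP; rewrite /chi /phi; case: pickP => [t /and3P[-> ->] //|none] /=.
have [g [gK incg gL tauE]] := circuit_partition_pairing hP.
have gN h : g h != h.
  by apply/eqP=> gh; move: (gL h); rewrite gh; case: (_ \in _).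
have [a av] : exists a, a \in halves_at v.
  by apply/set0Pn; rewrite -card_gt0 regular4.
(* Since [g] reverses orientation, one half-edge of the pair at [v] other than [{a, g a}] is
   oriented like [g a]. *)
have [c /andP[cv cP]] : exists c, (c \in halves_at v :\: [set a; g a]) &&
    ((c \in flatten P) == (g a \in flatten P)).
  have [c cD] : exists c, c \in halves_at v :\: [set a; g a].
    apply/set0Pn; rewrite -card_gt0 cardsDS ?regular4 ?cards2.
      by rewrite [a == _]eq_sym gN.
    apply/subsetP=> x; rewrite !inE in av *.
    by case/orP=> /eqP->; rewrite ?incg.
  have [cE|cE] := eqVneq (c \in flatten P) (g a \in flatten P).
    by exists c; rewrite cD cE eqxx.
  exists (g c); have -> : (g c \in flatten P) == (g a \in flatten P).
    by move: cE; rewrite !gL; do 2!case: (_ \in _).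
  move: cD; rewrite !inE incg !negb_or => /andP[/andP[ca cga] ->].
  by rewrite (can2_eq gK gK) (can_eq gK) ca cga.
move: cv; rewrite !inE in av *; rewrite negb_or => /andP[/andP[ca cga] cv].
pose pi := tperm (g a) c.
have pi_inc h : inc (pi h) = inc h.
  by rewrite /pi; case: tpermP => // ->; rewrite incg (eqP av) (eqP cv).
have pi_L h : (pi h \in flatten P) = (h \in flatten P).
  by rewrite /pi; case: tpermP => // ->; rewrite (eqP cP).
pose g' h := pi (g (pi h)).
have g'K : involutive g' by move=> h; rewrite /g' tpermK gK tpermK.
have g'L h : (g' h \in flatten P) = (h \notin flatten P).
  by rewrite pi_L gL pi_L.
have := none (transition_of g' v); rewrite transition_ofP //; first last.
- by move=> h; apply/eqP=> gh; move: (g'L h); rewrite gh; case: (_ \in _).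
- by move=> h; rewrite !pi_inc incg pi_inc.
(* By [none] the conjugated transition must equal [phi P v]. But [{a, c}] is one of its pairs,
   whereas [phi P v] pairs [a] with [g a]. *)
rewrite transition_of_respects // andbT /= => /negbFE/eqP /setP/(_ [set a; c]).
rewrite tauE => /esym.
have -> : [set a; c] \in transition_of g' v.
  have <- : g' a = c by rewrite /g' /pi [tperm _ _ a]tpermD ?gN ?tpermL.
  by apply: imset_f; rewrite inE.
case/imsetP=> h _ ac.
have := set21 a c; have := set22 a c; rewrite ac !inE => ch ah.
have gah : [set h; g h] = [set a; g a].
  by case/orP: ah => /eqP->; rewrite ?gK 1?setUC.
by move/setP/(_ c): gah; rewrite !inE ch (negPf ca) (negPf cga).
Qed.

(* A transition at v is determined by the half-edge paired with a fixed one. *)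
Lemma card_transitions_at v : #|transitions_at v| = 3.
Proof.
pose X := halves_at v; have X4 : #|X| = 4 by exact: regular4.
have [a aX] : exists a, a \in X by apply/set0Pn; rewrite -card_gt0 X4.
(* The transition pairing the fixed [a] with [b]; the three choices of [b] give all transitions. *)
pose tr b : {set {set H}} := [set [set a; b]; X :\: [set a; b]].
have aN b : [set a; b] != X :\: [set a; b].
  by apply/eqP=> /setP/(_ a); rewrite !inE eqxx.
have cardD b : b \in X :\ a ->
    [/\ [set a; b] \subset X, #|[set a; b]| = 2 & #|X :\: [set a; b]| = 2].
  rewrite !inE => /andP[ba bv].
  have abX : [set a; b] \subset X by rewrite subUset !sub1set aX inE.
  by rewrite cardsDS // X4 cards2 eq_sym ba.
have <- : #|[set tr b | b in X :\ a]| = 3.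
  rewrite card_in_imset => [|b c bX cX trE].
    by have := cardsD1 a X; rewrite aX X4 add1n => -[].
  have := set21 [set a; b] (X :\: [set a; b]); rewrite -/(tr b) trE !inE.
  case/orP=> /eqP/setP abE; last by have := abE a; rewrite !inE eqxx.
  have := abE b; rewrite !inE eqxx orbT => /esym/orP[] /eqP // ba.
  by move: bX; rewrite ba !inE eqxx.
apply: eq_card => t; apply/idP/imsetP=> [|[b bX ->]]; last first.
  have [abX c2 d2] := cardD b bX; rewrite inE; apply/andP; split; last first.
    by apply/forall_inP=> p; rewrite !inE => /orP[]/eqP->; apply/eqP.
  apply/and3P; split; first last.
  - by rewrite !inE negb_or !(eq_sym set0) -!card_gt0 c2 d2.
  - apply/trivIsetP=> p q; rewrite !inE => /orP[]/eqP-> /orP[]/eqP->;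
      rewrite ?eqxx // => _; last rewrite disjoint_sym;
      by rewrite -setI_eq0 setIDA [X in X :\: _]setIC -setIDA setDv setI0.
  - by rewrite /cover big_setU1 ?inE //= big_set1 -{1}(setIidPr abX) setID.
rewrite inE => /andP[/and3P[/eqP coverE triv t0] /forall_inP card2].
have aC : a \in cover t by rewrite coverE.
have pt : pblock t a \in t by rewrite pblock_mem.
have /cards2P[x [y [xy ptE]]] := card2 _ pt.
have {x y xy ptE}[b [ba ptE]] : exists b, b != a /\ pblock t a = [set a; b].
  have := mem_pblock t a; rewrite aC ptE !inE => /orP[]/eqP->.
    by exists y; rewrite eq_sym.
  by exists x; rewrite setUC.
have bX : b \in X :\ a.
  rewrite in_setD1 ba /X -coverE.
  by apply/bigcupP; exists (pblock t a); rewrite // ptE set22.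
have [abX c2 d2] := cardD b bX.
have other p : p \in t -> p != [set a; b] -> p = X :\: [set a; b].
  move=> tp pab; apply/eqP; rewrite eqEcard d2 (eqP (card2 p tp)) leqnn andbT.
  rewrite subsetD /X -coverE (bigcup_max p) //=.
  by apply: (trivIsetP triv); rewrite // -ptE.
exists b => //; apply/setP=> p; rewrite !inE; apply/idP/orP=> [tp|].
  by have [->|/(other p tp)->] := eqVneq p [set a; b]; [left|right].
case=> /eqP->; first by rewrite -ptE.
(* The complementary pair must be shown to belong to [t]: it is the block of any half-edge outside
   [{a, b}]. *)
have [c /setDP[cX cab]] : exists c, c \in X :\: [set a; b].
  by apply/set0Pn; rewrite -card_gt0 d2.
have cC : c \in cover t by rewrite coverE.
rewrite -(other (pblock t c)) ?pblock_mem //.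
by apply: contraNneq cab => <-; rewrite mem_pblock.
Qed.

Lemma tau_transition P v : circuit_partition P -> tau P v \in transitions_at v.
Proof.
case/circuit_partition_pairing=> g [gK incg gL ->]; apply: transition_ofP => //.
by move=> h; apply/eqP=> gh; move: (gL h); rewrite gh; case: (_ \in _).
Qed.

(** There are three transitions at [v], and only two are excluded. *)
Lemma psi_spec P v : circuit_partition P ->
  [&& psi P v \in transitions_at v, psi P v != phi P v & psi P v != chi P v].
Proof.
move=> hP; rewrite {1 2 3}/psi; case: pickP => [t ->//|none] /=.
have: transitions_at v \subset [set phi P v; chi P v].
  apply/subsetP=> t tv; have := none t; rewrite tv /= !inE => /negbT.
  by rewrite negb_and !negbK.
by move/subset_leq_card; rewrite card_transitions_at cards2; case: (_ != _).
Qed.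

Lemma transitions_atE P v : circuit_partition P ->
  transitions_at v = [set phi P v; chi P v; psi P v].
Proof.
move=> hP; have /andP[chiT cp] := chi_spec v hP.
have /and3P[psiT sp sc] := psi_spec v hP.
apply/esym/eqP; rewrite eqEcard card_transitions_at !subUset !sub1set chiT psiT.
rewrite tau_transition //= -setUA cardsU1 !inE cards2 negb_or.
by rewrite ![phi P v == _]eq_sym cp sp [chi _ _ == _]eq_sym sc.
Qed.

(** The half-edges covered by a transition form a nonempty set and determine the vertex. *)
Lemma transitions_at_inj v w t :
  t \in transitions_at v -> t \in transitions_at w -> v = w.
Proof.
rewrite !inE => /andP[/and3P[/eqP cv _ _] _] /andP[/and3P[/eqP cw _ _] _].
have [h] : exists h, h \in halves_at v.
  by apply/set0Pn; rewrite -card_gt0 regular4.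
move=> hv; have := hv; rewrite -cv cw.
by move: hv; rewrite !inE => /eqP-> /eqP.
Qed.

(** A cyclic word containing v, w, v, w in order also contains w, v, w, v from another starting
    point. This gives the symmetry of the interlacement matrix. *)
Lemma interlaced_sym P v w : interlaced P v w = interlaced P w v.
Proof.
rewrite /interlaced eq_sym; congr (_ && _); apply: eq_has => c.
have altc u z : [exists k : 'I_(size c),
      subseq [:: u; z; u; z] (rot k (map inc c))] ->
    [exists k : 'I_(size c), subseq [:: z; u; z; u] (rot k (map inc c))].
  move=> /existsP[k]; rewrite -(size_map inc) in k * => /subseq_alternate[j].
  by move=> ?; apply/existsP; exists j.
by apply/idP/idP; apply: altc.
Qed.

Lemma interlacement_mx_sym P : (interlacement_mx P)^T%R = interlacement_mx P.
Proof. by apply/matrixP=> i j; rewrite !mxE interlaced_sym. Qed.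

End Graph4Theory.

(** * Columns of the transition matroid in isotropic coordinates *)

Section TransitionMatroid.
Local Open Scope ring_scope.
Variables (F : graph4) (C : seq (seq (half_edge F))).
Hypothesis hC : circuit_partition C.
Notation n := #|vertex F|.
Notation M := (transition_matroid C).
Notation A := (interlacement_mx C).
Notation vec := (labelled_col (transition_label C) (transition_mx C)).

(* Maps phi, chi, psi at a vertex to (1,0), (0,1), (1,1): the coefficients of
   the columns of I and A in the column of the transition. *)
Definition transition_coord (v : vertex F) (t : {set {set half_edge F}}) :
    'F_2 * 'F_2 :=
  ((t != chi C v)%:R, (t != phi C v)%:R).

(** Two distinct nonzero vectors of the plane over ['F_2] are linearly independent, so their
    determinant is nonzero. *)
Lemma transition_coord_neq v t1 t2 :
    t1 \in transitions_at v -> t2 \in transitions_at v -> t1 != t2 ->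
  (transition_coord v t1).1 * (transition_coord v t2).2 -
  (transition_coord v t1).2 * (transition_coord v t2).1 != 0.
Proof.
have /andP[_ cp] := chi_spec v hC; have /and3P[_ sp sc] := psi_spec v hC.
rewrite !(transitions_atE v hC) !inE -!orbA /transition_coord.
case/or3P=> /eqP-> /or3P[]/eqP->; rewrite ?eqxx //= => _;
  by rewrite ?cp ?sp ?sc ?[phi C v == _]eq_sym ?cp ?sp.
Qed.

Lemma transition_label_phi (i : 'I_n) :
  transition_label C (lshift n (lshift n i)) = phi C (enum_val i).
Proof.
rewrite /transition_label -[lshift n _]/(unsplit (inl _)) unsplitK.
by rewrite -[lshift n i]/(unsplit (inl _)) unsplitK.
Qed.

Lemma transition_label_chi (i : 'I_n) :
  transition_label C (lshift n (rshift n i)) = chi C (enum_val i).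
Proof.
rewrite /transition_label -[lshift n _]/(unsplit (inl _)) unsplitK.
by rewrite -[rshift n i]/(unsplit (inr _)) unsplitK.
Qed.

Lemma transition_label_psi (i : 'I_n) :
  transition_label C (rshift (n + n) i) = psi C (enum_val i).
Proof.
by rewrite /transition_label -[rshift _ _]/(unsplit (inr _)) unsplitK.
Qed.

(** Injectivity makes [labelled_col] return the intended column. Labels at different vertices differ
    by [transitions_at_inj], and the three labels at one vertex are distinct. *)
Lemma transition_label_inj : injective (transition_label C).
Proof.
have inj (i i' : 'I_n) t t' :
    t \in transitions_at (enum_val i) -> t' \in transitions_at (enum_val i') ->
  t = t' -> i = i'.
  by move=> tT t'T tt'; apply/enum_val_inj/(transitions_at_inj tT); rewrite tt'.
have phiT v : phi C v \in transitions_at v := tau_transition v hC.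
have chiT v : chi C v \in transitions_at v by case/andP: (chi_spec v hC).
have psiT v : psi C v \in transitions_at v by case/and3P: (psi_spec v hC).
have cp v : chi C v <> phi C v by case/andP: (chi_spec v hC) => _ /eqP.
have sp v : psi C v <> phi C v by case/and3P: (psi_spec v hC) => _ /eqP.
have sc v : psi C v <> chi C v by case/and3P: (psi_spec v hC) => _ _ /eqP.
move=> j j'; case: (split_ordP j) => [k|i] ->;
  [case: (split_ordP k) => i -> |]; (case: (split_ordP j') => [k'|i'] ->;
  [case: (split_ordP k') => i' -> |]);
  rewrite ?transition_label_phi ?transition_label_chi ?transition_label_psi;
  move=> eq_t;
  (have ii' : i = i' by apply: inj eq_t; rewrite ?phiT ?chiT ?psiT);
  subst i' => //;
  by first [case: (cp _ eq_t) | case: (cp _ (esym eq_t))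
           |case: (sp _ eq_t) | case: (sp _ (esym eq_t))
           |case: (sc _ eq_t) | case: (sc _ (esym eq_t))].
Qed.

Lemma transition_colE (i : 'I_n) t : t \in transitions_at (enum_val i) ->
  vec t = isotropic_col A (transition_coord (enum_val i) t) i.
Proof.
have /andP[_ cp] := chi_spec (enum_val i) hC.
have /and3P[_ sp sc] := psi_spec (enum_val i) hC.
rewrite (transitions_atE _ hC) !inE -orbA /isotropic_col /transition_coord.
case/or3P=> /eqP->; rewrite /= ?eqxx ?cp ?sp ?sc ?[phi _ _ == _]eq_sym ?cp /=;
  rewrite ?scale0r ?scale1r ?addr0 ?add0r.
- rewrite -transition_label_phi (labelled_col_lab _ _ transition_label_inj).
  by rewrite /transition_mx !colKl colE mul1mx.
- rewrite -transition_label_chi (labelled_col_lab _ _ transition_label_inj).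
  by rewrite /transition_mx colKl colKr.
rewrite -transition_label_psi (labelled_col_lab _ _ transition_label_inj).
by rewrite /transition_mx colKr linearD /= [col i 1%:M]colE mul1mx.
Qed.

(** * Sets with at most one transition per vertex *)

Section Transversal.
Variable t : 'I_n -> {set {set half_edge F}}.
Hypothesis tT : forall i, t i \in transitions_at (enum_val i).
Notation tcol := (fun i =>
  isotropic_col A (transition_coord (enum_val i) (t i)) i).

Lemma transversal_inj : injective t.
Proof.
move=> i j tij; apply/enum_val_inj/(transitions_at_inj (tT i)).
by rewrite tij; apply: tT.
Qed.

Lemma transversal_sum (S : {set 'I_n}) (c : _ -> 'F_2) :
  \sum_(x in [set t i | i in S]) c x *: vec x = \sum_(i in S) c (t i) *: tcol i.
Proof.
rewrite big_imset /=; last by move=> i j _ _; exact: transversal_inj.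
by apply: eq_bigr => i _; rewrite (transition_colE (tT i)).
Qed.

Lemma transversal_ground (S : {set 'I_n}) :
  [set t i | i in S] \subset transitions F.
Proof.
apply/subsetP=> _ /imsetP[i _ ->].
by apply/bigcupP; exists (enum_val i) => //; apply: tT.
Qed.

(** As [t] is injective, coefficients may be indexed by vertices instead of transitions, the form
    required by the isotropic argument. *)
Lemma transversal_indepP (S : {set 'I_n}) :
  reflect (forall d, \sum_(i in S) d i *: tcol i = 0 -> {in S, d =1 fun=> 0})
          (indep M [set t i | i in S]).
Proof.
apply: (iffP (represented_indepP _ _ _ _)) => [[_ fS] d d0 i iS|fS].
  pose c x := if [pick j | t j == x] is Some j then d j else 0.
  have cE j : c (t j) = d j.
    rewrite /c; case: pickP => [k /eqP/transversal_inj->//|/(_ j)].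
    by rewrite eqxx.
  rewrite -cE; apply: fS; last exact: imset_f.
  by rewrite transversal_sum -[RHS]d0; apply: eq_bigr => j _; rewrite cE.
split=> [|c]; first exact: transversal_ground.
rewrite transversal_sum => /fS cS _ /imsetP[i iS ->].
exact: cS.
Qed.

End Transversal.

Lemma card_indep_transition B : indep M B -> (#|B| <= n)%N.
Proof. exact: represented_card_indep. Qed.

(** The representing matrix has [n] rows, so no independent set exceeds [n] elements. *)
Lemma basis_transition B : indep M B -> #|B| = n -> basis M B.
Proof.
move=> iB cB; apply/maxsetP; split=> // B' iB' BB'.
by apply/esym/eqP; rewrite eqEcard BB' cB card_indep_transition.
Qed.

(** * Completing a basis of the first partition by transitions of the second *)

Section TwoPartitions.
Variables P1 P2 : seq (seq (half_edge F)).
Hypotheses (hP1 : circuit_partition P1) (hP2 : circuit_partition P2).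
Hypothesis htau : forall v : vertex F, tau P1 v <> tau P2 v.

Lemma exchange_transition B1 : basis (restrict M (tau_set P1)) B1 ->
  let B2 := [set tau P2 v | v : vertex F & tau P1 v \notin B1] in
  indep M (B1 :|: B2) /\ #|B1 :|: B2| = n.
Proof.
move=> hB1 B2; pose t1 (i : 'I_n) := tau P1 (enum_val i).
pose t2 (i : 'I_n) := tau P2 (enum_val i).
(* [S] is the vertex set of [B1], and [t] the new transversal: the first partition on [S], the
   second elsewhere. *)
pose S := [set i | t1 i \in B1]; pose t i := if i \in S then t1 i else t2 i.
have t1T i : t1 i \in transitions_at (enum_val i) by exact: tau_transition.
have t2T i : t2 i \in transitions_at (enum_val i) by exact: tau_transition.
have t12 i : t1 i != t2 i by apply/eqP; rewrite /t1 /t2; apply: htau.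
have tT i : t i \in transitions_at (enum_val i) by rewrite /t; case: ifP.
have /maxsetp/andP[B1t iB1] := hB1.
have B1E : B1 = [set t1 i | i in S].
  apply/setP=> x; apply/idP/imsetP=> [xB|[i]]; last by rewrite inE => ? ->.
  have /imsetP[v _ xv] := subsetP B1t x xB.
  by exists (enum_rank v); rewrite ?inE /t1 enum_rankK -?xv.
have BE : B1 :|: B2 = [set t i | i in setT].
  apply/setP=> x; rewrite B1E; apply/setUP/imsetP=> [[/imsetP[i iS ->]|]|].
  - by exists i; rewrite // /t iS.
  - case/imsetP=> v; rewrite inE /= => vB ->.
    exists (enum_rank v) => //.
    by rewrite /t inE /t1 enum_rankK (negPf vB) /t2 enum_rankK.
  case=> i _ ->; rewrite /t; case: ifPn => iS; [left; exact: imset_f|right].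
  by apply/imsetP; exists (enum_val i); rewrite // inE; rewrite inE in iS.
split; last first.
  by rewrite BE card_imset ?cardsT ?card_ord //; exact: transversal_inj.
rewrite BE; apply/(transversal_indepP tT) => d d0 i _.
pose p (i : 'I_n) := transition_coord (enum_val i) (t1 i).
pose q (i : 'I_n) := transition_coord (enum_val i) (t2 i).
apply: (@isotropic_transversal _ _ A _ p q S) => //.
- exact: interlacement_mx_sym.
- by move=> j _; apply: transition_coord_neq; rewrite ?t1T ?t2T ?t12.
- by apply/(transversal_indepP t1T); rewrite -B1E.
- move=> u uS; have [|||c cE] := restrict_basis_span (t := t1 u) hB1.
  + exact: imset_f.
  + by apply/bigcupP; exists (enum_val u); rewrite ?t1T.
  + by rewrite inE in uS.
  exists (c \o t1); rewrite -(transition_colE (t1T u)) cE B1E.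
  exact: transversal_sum.
rewrite -[RHS]d0 [RHS](eq_bigl xpredT) => [|j]; last by rewrite inE.
by apply: eq_bigr => j _; rewrite /p /q /t; case: ifP.
Qed.

End TwoPartitions.
End TransitionMatroid.

Theorem theorem30 (F : graph4) (n : nat) (C P1 P2 : seq (seq (half_edge F)))
    (hn : #|vertex F| = n)
    (hC : euler_system C)
    (hP1 : circuit_partition P1) (hP2 : circuit_partition P2)
    (htau : forall v : vertex F, tau P1 v <> tau P2 v) :
  let M := transition_matroid C in
  (forall B1 : {set {set {set half_edge F}}},
     basis (restrict M (tau_set P1)) B1 ->
     basis M (B1 :|: [set tau P2 v | v : vertex F & tau P1 v \notin B1])) /\
  (rank M (tau_set P1 :|: tau_set P2) = n /\
   n <= rank M (tau_set P1) + rank M (tau_set P2)).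
Proof.
move=> M; case/andP: hC => {}hC _; rewrite -{}hn.
have exch := exchange_transition hC hP1 hP2 htau.
split=> [B1 /exch[iB cB]|]; first exact: basis_transition.
(* Any basis of the restriction serves; one is obtained by enlarging the empty set. *)
have [B1 /[dup] hB1 /exch[iB cB] _] :=
  @maxset_exists _ (indep (restrict M (tau_set P1))) set0 (indep0 _).
have /maxsetp/andP[B1t iB1] := hB1.
set B2 := [set _ | _ in _] in iB cB.
have B2t : B2 \subset tau_set P2.
  by apply/subsetP=> _ /imsetP[v _ ->]; exact: imset_f.
have rank_ge (B S : {set {set {set half_edge F}}}) :
    B \subset S -> indep M B -> #|B| <= rank M S.
  by move=> BS iB'; apply: (leq_bigmax_cond B); rewrite BS.
split.
  apply/eqP; rewrite eqn_leq; apply/andP; split.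
    by apply/bigmax_leqP=> B /andP[_]; exact: card_indep_transition.
  by rewrite -{1}cB rank_ge // setUSS.
(* The [n] elements split into [B1] and [B2], independent subsets of the respective transition
   sets. *)
rewrite -cB (leq_trans (leq_card_setU _ _)) // leq_add // rank_ge //.
exact: indepS (subsetUr _ _) iB.
Qed.
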